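(* For each integer $r$ and each non-negative integer $n$, \[ \sum_{k = 0}^n \binom {2k}{k} \binom {2(n - k)}{n-k} F_{6k+r} = 4^{n} \sum_{k = 0}^n \binom {n}{k}^2 F_{2(n+k)+r}, \qquad \sum_{k = 0}^n \binom {2k}{k} \binom {2(n - k)}{n-k} L_{6k+r} = 4^{n} \sum_{k = 0}^n \binom {n}{k}^2 L_{2(n+k)+r}. \]
   Context: $F_j$ and $L_j$ denote the Fibonacci and Lucas numbers: $F_0=0,F_1=1$, $L_0=2,L_1=1$, both satisfying $X_j=X_{j-1}+X_{j-2}$, extended to all integer indices via the recurrence (so $F_{-j}=(-1)^{j+1}F_j$, $L_{-j}=(-1)^jL_j$). *)

(* Defs.v *)
From mathcomp Require Import all_boot all_order all_algebra.
From mathcomp Require Import ring.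

Set Implicit Arguments.
Unset Strict Implicit.
Unset Printing Implicit Defensive.

Import GRing.Theory.
Local Open Scope ring_scope.

(* Consecutive terms (X_j, X_(j+1)) of a sequence satisfying
   X_j = X_(j-1) + X_(j-2), moved one index forward or backward. *)
Definition fib_next (p : int * int) : int * int := (p.2, p.1 + p.2).
Definition fib_prev (p : int * int) : int * int := (p.2 - p.1, p.1).

(* The two-sided sequence with X_0 = a and X_1 = b; recall that Negz n is
   the integer - (n + 1). *)
Definition fib_seq (a b : int) (j : int) : int :=
  match j with
  | Posz n => (iter n fib_next (a, b)).1
  | Negz n => (iter n.+1 fib_prev (a, b)).1
  end.

Definition Fib : int -> int := fib_seq 0 1.
Definition Luc : int -> int := fib_seq 2 1.

Lemma fib_seq0 (a b : int) : fib_seq a b 0 = a.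
Proof. by []. Qed.

Lemma fib_seq1 (a b : int) : fib_seq a b 1 = b.
Proof. by []. Qed.

Lemma fib_seq_rec (a b j : int) :
  fib_seq a b j = fib_seq a b (j - 1) + fib_seq a b (j - 2).
Proof.
case: j => [[|[|n]]|n].
- by rewrite /= addrC subrK.
- by rewrite /= addrC subrK.
- have -> : Posz n.+2 - 1 = Posz n.+1 by rewrite -addn1 PoszD addrK.
  have -> : Posz n.+2 - 2 = Posz n by rewrite -addn2 PoszD addrK.
  by rewrite /= addrC.
- have -> : Negz n - 1 = Negz n.+1 by rewrite !NegzE -opprD -PoszD addn1.
  have -> : Negz n - 2 = Negz n.+2 by rewrite !NegzE -opprD -PoszD addn2.
  by rewrite /=; ring.
Qed.

Lemma fib_seqN (a b : int) (n : nat) :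
  fib_seq a b (- n%:Z) = (iter n fib_prev (a, b)).1.
Proof. by case: n => [|n] //; rewrite -NegzE. Qed.

Lemma FibN (n : nat) : Fib (- n%:Z) = (-1) ^+ n.+1 * Fib n%:Z.
Proof.
rewrite /Fib fib_seqN /=; pose q m := iter m fib_next (0, 1).
suff -> : iter n fib_prev (0, 1) =
  ((-1) ^+ n.+1 * (q n).1, (-1) ^+ n * ((q n).2 - (q n).1)) by [].
elim: n => [|n IHn] //; rewrite iterS IHn /fib_prev /=.
by rewrite -/(q n) !exprS; congr (_, _); ring.
Qed.

Lemma LucN (n : nat) : Luc (- n%:Z) = (-1) ^+ n * Luc n%:Z.
Proof.
rewrite /Luc fib_seqN /=; pose q m := iter m fib_next (2, 1).
suff -> : iter n fib_prev (2, 1) =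
  ((-1) ^+ n * (q n).1, (-1) ^+ n.+1 * ((q n).2 - (q n).1)) by [].
elim: n => [|n IHn] //; rewrite iterS IHn /fib_prev /=.
by rewrite -/(q n) !exprS; congr (_, _); ring.
Qed.

(* Main.v *)
(* Put y = phi^2, phi the golden ratio (or its conjugate). The two sides have
   generating functions 1 / sqrt ((1 - 4 t) (1 - 4 y^3 t)) and
   1 / sqrt (1 - 2 (1 + y) s + (1 - y)^2 s^2) at s = 4 y t, and these agree
   because 2 y (1 + y) = 1 + y^3 and (1 - y)^2 = y. Instead of generating
   functions, we compare the three-term recurrences in n that they imply. Being
   linear in the powers of y, these recurrences hold with an arbitrary weight
   sequence f in place of these powers, with f \o succn replacing the product
   by y. *)
Require Import Defs.
From mathcomp Require Import all_boot all_order all_algebra.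
From mathcomp Require Import zify ring lra.

Import GRing.Theory.

Local Open Scope ring_scope.

Definition central_conv (n : nat) (f : nat -> int) : int :=
  \sum_(0 <= k < n.+1) 'C(2 * k, k)%:Z * 'C(2 * (n - k), n - k)%:Z * f k.

(** For [f k = y ^ k] this is (1 - y)^n P_n((1 + y) / (1 - y)), with P_n the Legendre polynomial. *)
Definition bin_sq_sum (n : nat) (f : nat -> int) : int :=
  \sum_(0 <= k < n.+1) 'C(n, k)%:Z ^+ 2 * f k.

Lemma mul_central_binS (k : nat) :
  k.+1%:Z * 'C(2 * k.+1, k.+1)%:Z = (4 * k%:Z + 2) * 'C(2 * k, k)%:Z.
Proof.
have e2 := mul_bin_down (2 * k).+1 k.
rewrite (_ : (2 * k.+1 = (2 * k).+2)%N); last by lia.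
have e3 : 'C((2 * k).+2, k.+1) = (2 * 'C((2 * k).+1, k))%N.
  rewrite binS -['C(_, k.+1)]bin_sub; last by lia.
  by rewrite (_ : ((2 * k).+1 - k.+1 = k)%N); lia.
rewrite e3.
have e4 : ((2 * k).+1 - k = k.+1)%N by lia.
rewrite e4 /= in e2.
lia.
Qed.

(** Split k + m + 2 as (k + 1) + (m + 1), and 4(k + m) + 6 as (4m + 2) + (4k + 4) for the first
    product and as (4k + 2) + (4m + 4) for the second; [mul_central_binS] matches all the pieces. *)
Lemma central_conv_coef (k m : nat) :
  (k + m).+2%:Z * ('C(2 * k.+1, k.+1)%:Z * 'C(2 * m.+1, m.+1)%:Z)
  = 2 * (2 * (k + m)%:Z + 3)
      * ('C(2 * k.+1, k.+1)%:Z * 'C(2 * m, m)%:Z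
         + 'C(2 * k, k)%:Z * 'C(2 * m.+1, m.+1)%:Z)
    - 16 * (k + m).+1%:Z * ('C(2 * k, k)%:Z * 'C(2 * m, m)%:Z).
Proof.
move: (mul_central_binS k) (mul_central_binS m).
set a := Posz 'C(2 * k, k); set a' := Posz 'C(2 * k.+1, k.+1).
set b := Posz 'C(2 * m, m); set b' := Posz 'C(2 * m.+1, m.+1).
rewrite !(intS, PoszD) => ea eb.
have := congr1 ( *%R b') ea; have := congr1 ( *%R b) ea.
have := congr1 ( *%R a') eb; have := congr1 ( *%R a) eb.
lra.
Qed.

Lemma central_conv_rec (n : nat) (f : nat -> int) :
  n.+2%:Z * central_conv n.+2 f
  = 2 * (2 * n%:Z + 3)
      * (central_conv n.+1 f + central_conv n.+1 (f \o succn))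
    - 16 * n.+1%:Z * central_conv n (f \o succn).
Proof.
rewrite /central_conv.
rewrite [in LHS]big_nat_recl // [in LHS]big_nat_recr //=.
rewrite [X in _ = _ * (X + _) - _]big_nat_recl //.
rewrite [X in _ = _ * (_ + X) - _]big_nat_recr //=.
rewrite !subnn !subn0 !muln0 !bin0.
set S0 := (X in _ * (_ + (X + _)) = _).
set S1 := (X in _ * (_ + X + _) - _).
set S2 := (X in _ * (_ + (X + _)) - _).
set S3 := (X in _ - _ * X).
have eS : n.+2%:Z * S0
    = 2 * (2 * n%:Z + 3) * (S1 + S2) - 16 * n.+1%:Z * S3.
  rewrite -big_split /= !mulr_sumr -sumrB; apply: eq_big_nat => i /andP[_ lin].
  have [m ->] : exists m, n = (i + m)%N by exists (n - i)%N; lia.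
  have -> : (i + m - i = m)%N by lia.
  have -> : ((i + m).+1 - i = m.+1)%N by lia.
  have -> : ((i + m).+1 - i.+1 = m)%N by lia.
  have -> : ((i + m).+2 - i.+1 = m.+1)%N by lia.
  have e := congr1 ( *%R (f i.+1)) (central_conv_coef i m).
  lra.
(* The extreme weights [f 0] and [f n.+2] each occur in only two of the sums, where the recurrence
   reduces to [e]. *)
have e := mul_central_binS n.+1.
have n1 : n.+1%:Z = n%:Z + 1 by lia.
have n2 : n.+2%:Z = n%:Z + 2 by lia.
have := congr1 ( *%R (f 0)) e; have := congr1 ( *%R (f n.+2)) e.
rewrite n1 n2 in eS *.
lra.
Qed.

Lemma bin_sq_coef (n k : nat) :
  n.+2%:Z * 'C(n.+2, k.+2)%:Z ^+ 2
  = (2 * n%:Z + 3) * ('C(n.+1, k.+2)%:Z ^+ 2 + 'C(n.+1, k.+1)%:Z ^+ 2)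
    - n.+1%:Z * ('C(n, k.+2)%:Z ^+ 2 - 2 * 'C(n, k.+1)%:Z ^+ 2
                 + 'C(n, k)%:Z ^+ 2).
Proof.
have step j : j.+1%:Z * 'C(n, j.+1)%:Z = (n%:Z - j%:Z) * 'C(n, j)%:Z.
  have [ltnj|lejn] := ltnP n j; first by rewrite !bin_small ?mulr0 //; lia.
  by rewrite subzn // -!PoszM mul_bin_left.
have := step k; have := step k.+1.
rewrite !binS !(intS, PoszD).
set x := Posz 'C(n, k.+2); set y := Posz 'C(n, k.+1).
set z := Posz 'C(n, k) => exy eyz.
(* After Pascal's rule the two sides of the goal differ by twice this expression. It vanishes on
   splitting n + 2 as (k + 2) + (n - k) in the [x * z] term. *)
have key : (n%:Z + 2) * x * z + x * y + y * z - n%:Z * y ^+ 2 = 0.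
  have := congr1 ( *%R y) exy; have := congr1 ( *%R z) exy.
  have := congr1 ( *%R x) eyz; have := congr1 ( *%R y) eyz.
  lra.
lra.
Qed.

Lemma bin_sq_sum_widen (n m : nat) (f : nat -> int) :
  (n <= m)%N ->
  bin_sq_sum n f = \sum_(0 <= k < m.+1) 'C(n, k)%:Z ^+ 2 * f k.
Proof.
move=> lenm; rewrite (big_cat_nat _ (n := n.+1)) //=.
rewrite [X in _ + X]big_nat_cond [X in _ + X]big1 ?addr0 // => i /andP[].
by move=> /andP[ltni _] _; rewrite bin_small // expr0n mul0r.
Qed.

Lemma bin_sq_sum_rec (n : nat) (f : nat -> int) :
  n.+2%:Z * bin_sq_sum n.+2 f
  = (2 * n%:Z + 3) * (bin_sq_sum n.+1 f + bin_sq_sum n.+1 (f \o succn))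
    - n.+1%:Z * (bin_sq_sum n f - 2 * bin_sq_sum n (f \o succn)
                 + bin_sq_sum n (f \o succn \o succn)).
Proof.
(* Zero terms are added so that every sum reaches the weight [f n.+2]; once [f 0] and [f 1] are
   split off, coefficients of [f i.+2] can be compared. *)
rewrite (@bin_sq_sum_widen n.+1 n.+2 f) //.
rewrite (@bin_sq_sum_widen n n.+2 f); last by lia.
rewrite (@bin_sq_sum_widen n n.+1 (f \o succn)) // /bin_sq_sum.
rewrite ![\sum_(0 <= _ < n.+3) _]big_nat_recl //.
rewrite ![\sum_(0 <= _ < n.+2) _]big_nat_recl //=.
rewrite !bin0 !bin1.
set S0 := (X in n.+2%:Z * (_ + (_ + X)) = _).
set S1 := (X in _ * (_ + (_ + X) + _) - _).
set S2 := (X in _ * (_ + (_ + X)) - _).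
set S3 := (X in _ - _ * (_ + (_ + X) - _ + _)).
set S4 := (X in _ - _ * (_ - 2 * (_ + X) + _)).
set S5 := (X in _ - _ * (_ - _ + X)).
have eS : n.+2%:Z * S0
    = (2 * n%:Z + 3) * (S1 + S2) - n.+1%:Z * (S3 - 2 * S4 + S5).
  rewrite -big_split /= !mulr_sumr -sumrB -big_split /= mulr_sumr -sumrB.
  apply: eq_bigr => i _.
  have e := congr1 ( *%R (f i.+2)) (bin_sq_coef n i).
  lra.
have n1 : n.+1%:Z = n%:Z + 1 by lia.
have n2 : n.+2%:Z = n%:Z + 2 by lia.
rewrite n1 n2 in eS *.
lra.
Qed.

Lemma eq_bin_sq_sum (n : nat) (f g : nat -> int) :
  f =1 g -> bin_sq_sum n f = bin_sq_sum n g.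
Proof. by move=> efg; apply: eq_bigr => k _; rewrite efg. Qed.

Lemma eq_central_conv (n : nat) (f g : nat -> int) :
  f =1 g -> central_conv n f = central_conv n g.
Proof. by move=> efg; apply: eq_bigr => k _; rewrite efg. Qed.

Section FibonacciLike.

Variable X : int -> int.
Hypothesis XE : forall j, X j = X (j - 1) + X (j - 2).

(** This is (1 - y)^2 = y in the form 1 + y^2 = 3y, a shift of the index by 2 acting as y. *)
Lemma fib_like_add4 (j : int) : X j + X (j + 4) = 3 * X (j + 2).
Proof.
have e4 := XE (j + 4); have e3 := XE (j + 3); have e2 := XE (j + 2).
move: e4 e3 e2.
rewrite (_ : j + 4 - 1 = j + 3); last by ring.
rewrite (_ : j + 4 - 2 = j + 2); last by ring.
rewrite (_ : j + 3 - 1 = j + 2); last by ring.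
rewrite (_ : j + 3 - 2 = j + 1); last by ring.
rewrite (_ : j + 2 - 1 = j + 1); last by ring.
rewrite addrK => e4 e3 e2.
lra.
Qed.

(** This is 1 + y^3 = 2y(1 + y), the sum of 1 + y^2 = 3y and its multiple by y. *)
Lemma fib_like_add6 (j : int) :
  X j + X (j + 6) = 2 * (X (j + 2) + X (j + 4)).
Proof.
have e0 := fib_like_add4 j; have e2 := fib_like_add4 (j + 2).
rewrite -!(addrA j) in e2.
have -> : X (j + 6) = 3 * X (j + 4) - X (j + 2) by rewrite -e2; ring.
lra.
Qed.

Lemma bin_sq_sum_fib4 (n : nat) (s : int) :
  bin_sq_sum n (fun k => X (2 * k%:Z + s))
    + bin_sq_sum n (fun k => X (2 * k%:Z + (s + 4)))
  = 3 * bin_sq_sum n (fun k => X (2 * k%:Z + (s + 2))).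
Proof.
rewrite -big_split mulr_sumr; apply: eq_bigr => k _ /=.
have e := congr1 ( *%R ('C(n, k)%:Z ^+ 2))
  (fib_like_add4 (2 * k%:Z + s)).
rewrite !(addrA _ s).
lra.
Qed.

Lemma bin_sq_sum_fib6 (n : nat) (s : int) :
  bin_sq_sum n (fun k => X (2 * k%:Z + s))
    + bin_sq_sum n (fun k => X (2 * k%:Z + (s + 6)))
  = 2 * (bin_sq_sum n (fun k => X (2 * k%:Z + (s + 2)))
         + bin_sq_sum n (fun k => X (2 * k%:Z + (s + 4)))).
Proof.
rewrite -!big_split mulr_sumr; apply: eq_bigr => k _ /=.
have e := congr1 ( *%R ('C(n, k)%:Z ^+ 2))
  (fib_like_add6 (2 * k%:Z + s)).
rewrite !(addrA _ s).
lra.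
Qed.

Lemma central_conv_fib (n : nat) (r : int) :
  central_conv n (fun k => X (6 * k%:Z + r))
  = 4 ^+ n * bin_sq_sum n (fun k => X (2 * k%:Z + (2 * n%:Z + r))).
Proof.
(* The recurrences have order two, so two consecutive cases are carried along; [r] stays general
   because [f \o succn] replaces it by [r + 6]. *)
suff [] : (forall r, central_conv n (fun k => X (6 * k%:Z + r))
      = 4 ^+ n * bin_sq_sum n (fun k => X (2 * k%:Z + (2 * n%:Z + r))))
   /\ (forall r, central_conv n.+1 (fun k => X (6 * k%:Z + r))
      = 4 ^+ n.+1 * bin_sq_sum n.+1
          (fun k => X (2 * k%:Z + (2 * n.+1%:Z + r)))) by [].
elim: n {r} => [|n [IHn IHn1]]; split=> // r.
- by rewrite /central_conv /bin_sq_sum !big_nat1 !mulr0 !add0r !mul1r.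
- rewrite /central_conv /bin_sq_sum !big_nat_recr //= !big_geq //.
  rewrite !mulr0 !mulr1 !add0r.
  have e := fib_like_add6 r.
  rewrite (_ : 2 + (2 + r) = r + 4); last by ring.
  rewrite (addrC 2 r) (addrC 6 r) expr1.
  rewrite !bin0 !binn (_ : 'C(2 * (1 - 0), 1 - 0) = 2%N) //.
  lra.
have n2_neq0 : n.+2%:Z != 0 by [].
apply: (mulfI n2_neq0); rewrite central_conv_rec mulrCA bin_sq_sum_rec.
rewrite !(@eq_central_conv _ (_ \o succn) (fun k => X (6 * k%:Z + (r + 6))));
  try by move=> k /=; congr X; rewrite intS; ring.
rewrite !IHn1 IHn.
pose s := 2 * n%:Z + r.
(* Abstracting the sums as H makes each rewrite below consume the next one. *)
have [H HE] : exists H : nat -> int -> int,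
    forall m t, bin_sq_sum m (fun k => X (2 * k%:Z + (s + t))) = H m t.
  by eexists.
have eh m t (f : nat -> int) :
    (forall k, f k = X (2 * k%:Z + (s + t))) -> bin_sq_sum m f = H m t.
  by move=> ef; rewrite -HE; apply: eq_bin_sq_sum.
have n1 : n.+1%:Z = n%:Z + 1 by lia.
have n2 : n.+2%:Z = n%:Z + 2 by lia.
(* Offsets relative to [s]: each increment of n in [2 * n%:Z] adds 2, passing to [r + 6] adds 6, and
   on the right each [succn] adds 2. *)
rewrite (eh n.+1 2); last first.
  by move=> k; congr X; rewrite n1 /s; ring.
rewrite (eh n.+1 8); last by move=> k; congr X; rewrite n1 /s; ring.
rewrite (eh n 6); last by move=> k; congr X; rewrite /s; ring.
rewrite (eh n.+1 4); last by move=> k; congr X; rewrite n2 /s; ring.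
rewrite (eh n.+1 6); last first.
  by move=> k /=; congr X; rewrite n2 (intS k) /s; ring.
rewrite (eh n 4); last by move=> k; congr X; rewrite n2 /s; ring.
rewrite (eh n 6); last first.
  by move=> k /=; congr X; rewrite n2 (intS k) /s; ring.
rewrite (eh n 8); last first.
  by move=> k /=; congr X; rewrite n2 (intS k.+1) (intS k) /s; ring.
(* [e4] collapses the second difference [H n 4 - 2 * H n 6 + H n 8] to [H n 6]; [e6] matches the
   terms at [n.+1]. *)
have e4 := bin_sq_sum_fib4 n (s + 4); have e6 := bin_sq_sum_fib6 n.+1 (s + 2).
rewrite -!(addrA s) !HE in e4 e6.
rewrite !exprS n1; set c := 4 ^+ n.
have := congr1 ( *%R (16 * c * (n%:Z + 1))) e4.
have := congr1 ( *%R (8 * c * (2 * n%:Z + 3))) e6.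
lra.
Qed.

End FibonacciLike.

Theorem theorem24 (r : int) (n : nat) :
  \sum_(0 <= k < n.+1)
      ('C(2 * k, k)%:Z * 'C(2 * (n - k), n - k)%:Z * Fib (6 * k%:Z + r))
    = 4 ^+ n * \sum_(0 <= k < n.+1)
        (('C(n, k)%:Z) ^+ 2 * Fib (2 * (n%:Z + k%:Z) + r))
  /\
  \sum_(0 <= k < n.+1)
      ('C(2 * k, k)%:Z * 'C(2 * (n - k), n - k)%:Z * Luc (6 * k%:Z + r))
    = 4 ^+ n * \sum_(0 <= k < n.+1)
        (('C(n, k)%:Z) ^+ 2 * Luc (2 * (n%:Z + k%:Z) + r)).
Proof.
have idx (k : nat) : 2 * k%:Z + (2 * n%:Z + r) = 2 * (n%:Z + k%:Z) + r by ring.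
split; [have := central_conv_fib _ (fib_seq_rec 0 1) n r
       | have := central_conv_fib _ (fib_seq_rec 2 1) n r];
  by rewrite /central_conv => ->; congr (_ * _); apply: eq_bigr => k _;
     rewrite idx.
Qed.
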